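(* Let $(P,\preceq)$ be an infinite, locally finite lattice, let $f:P\to\mathbb{R}$ satisfy $f(x)>0$ for all $x\in P$, and let $x_1,\dots,x_n$ be distinct elements of $P$ such that $x_i\preceq x_j$ implies $i\le j$; put $S_n=\{x_1,\dots,x_n\}$. Then: (1) if $S_n$ is a $\wedge$-tree set and $f$ is strictly order-preserving, then the meet matrix $(S_n)_f$ is positive definite; (2) if $S_n$ is a $\vee$-tree set and $f$ is strictly order-reversing, then the join matrix $[S_n]_f$ is positive definite.
   Context: $\mathrm{meetcl}(S_n)$ (resp. $\mathrm{joincl}(S_n)$) denotes the meet subsemilattice (resp. join subsemilattice) of $P$ generated by $S_n$, i.e. the smallest subset of $P$ containing $S_n$ and closed under $\wedge$ (resp. $\vee$). $S_n$ is a $\wedge$-tree set if the Hasse diagram of $\mathrm{meetcl}(S_n)$, regarded as an undirected graph, is a tree; it is a $\vee$-tree set if the Hasse diagram of $\mathrm{joincl}(S_n)$ is a tree. $f$ is strictly order-preserving if $x\prec y$ implies $f(x)<f(y)$, and strictly order-reversing if $x\prec y$ implies $f(y)<f(x)$ (here $x\prec y$ means $x\preceq y$, $x\ne y$). The meet matrix $(S_n)_f$ has $(i,j)$ entry $f(x_i\wedge x_j)$ and the join matrix $[S_n]_f$ has $(i,j)$ entry $f(x_i\vee x_j)$. *)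

(* Defs.v *)
From mathcomp Require Import all_boot all_order all_algebra.
From mathcomp Require Import all_classical all_reals.

Set Implicit Arguments.
Unset Strict Implicit.
Unset Printing Implicit Defensive.

Import Order.TTheory GRing.Theory Num.Theory.

Local Open Scope classical_set_scope.
Local Open Scope ring_scope.

Definition locally_finite (d : Order.disp_t) (P : porderType d) : Prop :=
  forall a b : P, finite_set [set z : P | (a <= z <= b)%O].

Definition meetcl (d : Order.disp_t) (P : latticeType d) (S : set P) : set P :=
  smallest (fun A : set P => forall a b, A a -> A b -> A (Order.meet a b)) S.

Definition joincl (d : Order.disp_t) (P : latticeType d) (S : set P) : set P :=
  smallest (fun A : set P => forall a b, A a -> A b -> A (Order.join a b)) S.

(* The covering relation is that of A with the induced order: only elements
   of A are considered between x and y. *)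
Definition covered_in (d : Order.disp_t) (P : porderType d) (A : set P)
    (x y : P) : Prop :=
  [/\ A x, A y, (x < y)%O & forall z, A z -> ~ (x < z < y)%O].

Definition hasse (d : Order.disp_t) (P : porderType d) (A : set P) : rel P :=
  fun x y => `[< covered_in A x y \/ covered_in A y x >].

Definition graph_connected (T : eqType) (V : set T) (e : rel T) : Prop :=
  forall x y, V x -> V y ->
    exists p : seq T, [/\ [set` p] `<=` V, path e x p & last x p = y].

(* For a symmetric irreflexive e, ucycle also holds of the empty sequence and
   of [:: x; y] with e x y; genuine cycles have at least 3 vertices. *)
Definition graph_acyclic (T : eqType) (V : set T) (e : rel T) : Prop :=
  forall c : seq T, [set` c] `<=` V -> ucycle e c -> (size c <= 2)%N.

Definition is_tree (T : eqType) (V : set T) (e : rel T) : Prop :=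
  [/\ V !=set0, graph_connected V e & graph_acyclic V e].

Definition meet_tree_set (d : Order.disp_t) (P : latticeType d) (S : set P) :=
  is_tree (meetcl S) (hasse (meetcl S)).

Definition join_tree_set (d : Order.disp_t) (P : latticeType d) (S : set P) :=
  is_tree (joincl S) (hasse (joincl S)).

Definition strictly_order_preserving (d : Order.disp_t) (P : porderType d)
    (R : realType) (f : P -> R) : Prop :=
  forall x y : P, (x < y)%O -> f x < f y.

Definition strictly_order_reversing (d : Order.disp_t) (P : porderType d)
    (R : realType) (f : P -> R) : Prop :=
  forall x y : P, (x < y)%O -> f y < f x.

Definition meet_matrix (d : Order.disp_t) (P : latticeType d) (R : realType)
    (n : nat) (x : 'I_n -> P) (f : P -> R) : 'M[R]_n :=
  \matrix_(i < n, j < n) f (Order.meet (x i) (x j)).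

Definition join_matrix (d : Order.disp_t) (P : latticeType d) (R : realType)
    (n : nat) (x : 'I_n -> P) (f : P -> R) : 'M[R]_n :=
  \matrix_(i < n, j < n) f (Order.join (x i) (x j)).

Definition posdefmx (R : realType) (n : nat) (A : 'M[R]_n) : Prop :=
  A^T = A /\ forall v : 'cV[R]_n, v != 0 -> 0 < (v^T *m A *m v) 0 0.

(* Main.v *)
(** If the Hasse diagram of M = meetcl S is acyclic, the down-set of every
    element of M is a chain: if a, b were incomparable below z, with z minimal,
    then saturated chains meet(a, b) -> a -> z and meet(a, b) -> b -> z would
    be disjoint inside and form a cycle.  Let T be the set of pairwise meets of
    the x_i.  As f is positive and strictly increasing along chains, f y is the
    sum over z <= y in T of positive weights g z, where g z is the increment of
    f from the predecessor of z to z.  Hence the quadratic form of the meet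
    matrix is the sum over z in T of g z * (sum of v_i over z <= x_i)^2, and
    the term z = x_i is nonzero when x_i is maximal with v_i != 0.  The join
    case is the meet case in the dual lattice. *)

Require Import Defs.
From mathcomp Require Import all_boot all_order all_algebra.
From mathcomp Require Import all_classical all_reals.

Set Implicit Arguments.
Unset Strict Implicit.
Unset Printing Implicit Defensive.

Import Order.TTheory GRing.Theory Num.Theory.

Local Open Scope classical_set_scope.
Local Open Scope ring_scope.

(** * Finite intervals and saturated chains *)

Lemma count_ltn (T : eqType) (a1 a2 : pred T) (s : seq T) (w : T) :
  subpred a1 a2 -> w \in s -> a2 w -> ~~ a1 w -> (count a1 s < count a2 s)%N.
Proof.
move=> a12 ws a2w a1w; elim: s ws => //= y s IHs.
rewrite inE => /predU1P[<-|/IHs lts].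
  by rewrite a2w (negPf a1w) add0n add1n ltnS sub_count.
rewrite -addnS leq_add //.
by case: (boolP (a1 y)) => // /a12 ->.
Qed.

(** A proper subinterval loses an endpoint of the larger one, so it contains fewer elements of the
    finite list [s] that enumerates the outermost interval. *)
Lemma interval_ind (d : Order.disp_t) (P : porderType d) (Q : P -> P -> Prop) :
  locally_finite P ->
  (forall a b : P, (a <= b)%O ->
     (forall a' b' : P, (a <= a')%O -> (a' <= b')%O -> (b' <= b)%O ->
        (a < a')%O || (b' < b)%O -> Q a' b') -> Q a b) ->
  forall a b : P, (a <= b)%O -> Q a b.
Proof.
move=> lfP IH a0 b0 ab0.
have /finite_seqP[s sE] := lfP a0 b0.
have ins z : (a0 <= z <= b0)%O -> z \in s.
  by move=> zab; have: [set` s] z by rewrite -sE.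
pose N a b := count (fun z => a <= z <= b)%O s.
suff: forall k a b, (N a b < k)%N -> (a0 <= a)%O -> (b <= b0)%O ->
    (a <= b)%O -> Q a b by move=> /(_ (N a0 b0).+1); apply.
elim=> // k IHk a b Nk a0a bb0 ab; apply: (IH) => // a' b' aa' ab' bb' ne.
apply: IHk => //; [|exact: le_trans aa'|exact: le_trans bb0].
rewrite ltnS in Nk; apply: leq_trans Nk.
have sub : subpred (fun z => a' <= z <= b')%O (fun z => a <= z <= b)%O.
  by move=> z /andP[h1 h2]; rewrite (le_trans aa' h1) (le_trans h2 bb').
case/orP: ne => lt.
  apply: (@count_ltn _ _ _ _ a) => //; last by rewrite (lt_geF lt).
    by rewrite ins // a0a (le_trans ab bb0).
  by rewrite lexx.
apply: (@count_ltn _ _ _ _ b) => //; last by rewrite (lt_geF lt) andbF.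
  by rewrite ins // bb0 (le_trans a0a ab).
by rewrite ab lexx.
Qed.

(** An element of [A] strictly inside the interval splits it into two smaller ones whose chains
    concatenate; if there is none, distinct endpoints form a covering pair. *)
Lemma saturated_chain (d : Order.disp_t) (P : porderType d) (A : set P) :
  locally_finite P -> forall a b : P, (a <= b)%O -> A a -> A b ->
  exists2 p, path (fun x y => `[< covered_in A x y >]) a p & last a p = b.
Proof.
move=> lfP; apply: (@interval_ind d P (fun a b => A a -> A b -> _) lfP).
move=> a b ab IH Aa Ab.
have [->|ne] := eqVneq a b; first by exists [::].
have ltab : (a < b)%O by rewrite lt_neqAle ne.
have [[w Aw /andP[aw wb]]|no] := pselect (exists2 w, A w & (a < w < b)%O).
  have [||p pp pw] := IH a w _ (ltW aw) (ltW wb) _ Aa Aw; rewrite ?wb ?orbT//.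
  have [||q qp qb] := IH w b (ltW aw) (ltW wb) _ _ Aw Ab; rewrite ?aw //.
  by exists (p ++ q); rewrite ?cat_path ?last_cat pw ?pp.
exists [:: b] => //=; rewrite andbT; apply/asboolP; split => // z Az azb.
by apply: no; exists z.
Qed.

(** * Down-sets in an acyclic Hasse diagram *)

Lemma acyclic_downset_chain (d : Order.disp_t) (P : latticeType d) (A : set P) :
  locally_finite P ->
  (forall a b, A a -> A b -> A (Order.meet a b)) ->
  graph_acyclic A (hasse A) ->
  forall z a b : P, A z -> A a -> A b -> (a <= z)%O -> (b <= z)%O ->
  (a >=< b)%O.
Proof.
move=> lfP meetA acA z a b Az Aa Ab az bz; move: Aa Ab Az bz.
(* Here [b] stays fixed; the induction hypothesis serves only for the same [a] and a smaller top
   [w], in [zmin]. *)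
move: a z az.
apply: (@interval_ind d P
  (fun a z => A a -> A b -> A z -> (b <= z)%O -> _) lfP).
move=> a z az IH Aa Ab Az bz.
apply/negPn/negP => inc.
have nab : ~~ (a <= b)%O by apply: contra inc; rewrite /Order.comparable => ->.
have nba : ~~ (b <= a)%O.
  by apply: contra inc; rewrite /Order.comparable => ->; rewrite orbT.
have zmin w : A w -> (a <= w)%O -> (b <= w)%O -> ~~ (w < z)%O.
  move=> Aw aw bw; apply: contra inc => wz.
  by apply: (IH a w); rewrite ?lexx ?(ltW wz) ?wz ?orbT.
have saz : (a < z)%O by rewrite lt_neqAle az andbT; apply: contraNneq nba => ->.
have sbz : (b < z)%O by rewrite lt_neqAle bz andbT; apply: contraNneq nab => ->.
set c := Order.meet a b.
have Ac : A c by exact: meetA.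
have sca : (c < a)%O by rewrite lt_neqAle leIl andbT eq_meetl.
have scb : (c < b)%O by rewrite lt_neqAle leIr andbT eq_meetr.
have [p1 p1P p1e] := saturated_chain lfP (ltW sca) Ac Aa.
have [q1 q1P q1e] := saturated_chain lfP (ltW saz) Aa Az.
have [p2 p2P p2e] := saturated_chain lfP (ltW scb) Ac Ab.
have [q2 q2P q2e] := saturated_chain lfP (ltW sbz) Ab Az.
have covlt u r : path (fun x y => `[< covered_in A x y >]) u r ->
    path <%O u r by apply: sub_path => x y /asboolP[].
have covA u r : path (fun x y => `[< covered_in A x y >]) u r ->
    {in r, forall w, A w}.
  elim: r u => //= v r IHr u /andP[/asboolP[_ Av _ _] vr] w.
  by rewrite inE => /predU1P[-> //|]; exact: IHr vr w.
have covle u r w : path (fun x y => `[< covered_in A x y >]) u r -> w \in r ->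
    (u < w <= last u r)%O.
  move=> ur wr; have /covlt := ur.
  rewrite lt_path_pairwise pairwise_cons => /andP[/allP -> //].
  case/lastP: r wr {ur} => // r v; rewrite last_rcons mem_rcons inE.
  rewrite pairwise_rcons => /predU1P[->|wr]; first by rewrite lexx.
  by move=> /andP[/allP/(_ _ wr)/ltW].
(* The cycle climbs from [c] through [a] to [z] and returns along [rev m]; [z] is dropped from the
   chain through [b] so as not to occur twice. *)
have [m mE] : exists m, p2 ++ q2 = rcons m z.
  have : last c (p2 ++ q2) = z by rewrite last_cat p2e.
  case/lastP: (p2 ++ q2) => [/= cz|m z'].
    by move: (lt_trans scb sbz); rewrite cz ltxx.
  by rewrite last_rcons => ->; exists m.
have l1P : path (fun x y => `[< covered_in A x y >]) c (p1 ++ q1).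
  by rewrite cat_path p1P p1e.
have l2P : path (fun x y => `[< covered_in A x y >]) c (rcons m z).
  by rewrite -mE cat_path p2P p2e.
have l1z : last c (p1 ++ q1) = z by rewrite last_cat p1e.
have hasseS : subrel (fun x y => `[< covered_in A x y >]) (hasse A).
  by move=> u v /asboolP uv; apply/asboolP; left.
have hasseC u v : hasse A u v = hasse A v u.
  by rewrite /hasse; apply/asboolP/asboolP => -[]; auto.
(* Together with [c], nonempty [p1] and [q1] give the cycle at least three vertices. *)
have p1n : (0 < size p1)%N.
  by case: (p1) p1e => //= ca; move: sca; rewrite ca ltxx.
have q1n : (0 < size q1)%N.
  by case: (q1) q1e => //= ca; move: saz; rewrite ca ltxx.
have ml w : w \in m -> (c < w < z)%O && ((w <= b)%O || (b < w)%O).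
  move=> wm.
  have /covlt := l2P; rewrite lt_path_pairwise /= pairwise_rcons all_rcons.
  move=> /andP[/andP[_ /allP ->//] /andP[/allP ->//= _]].
  have : w \in p2 ++ q2 by rewrite mE mem_rcons inE wm orbT.
  rewrite mem_cat => /orP[] wp.
    by have /andP[_] := covle _ _ _ p2P wp; rewrite p2e => ->.
  by have /andP[-> _] := covle _ _ _ q2P wp; rewrite orbT.
have /acA : [set` c :: (p1 ++ q1) ++ rev m] `<=` A.
  move=> w /=; rewrite inE mem_cat mem_rev => /predU1P[->//|/orP[|wm]].
    exact: covA l1P w.
  by apply: (covA _ _ l2P); rewrite mem_rcons inE wm orbT.
suff cyc : ucycle (hasse A) (c :: (p1 ++ q1) ++ rev m).
  move/(_ cyc) => /=; rewrite !size_cat.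
  case: (size p1) p1n => // ?; case: (size q1) q1n => // ?.
  by rewrite addSn addnS.
apply/andP; split.
  rewrite /= rcons_cat cat_path (sub_path hasseS l1P) l1z /=.
  (* The descent from [z] to [c] is the second chain reversed, a path because [hasse] is
     symmetric. *)
  rewrite -rev_cons -[c :: m](belast_rcons _ _ z).
  rewrite -{1}(last_rcons c m z) rev_path.
  by rewrite (eq_path (e' := hasse A)) ?(sub_path hasseS l2P).
rewrite -cat_cons cat_uniq rev_uniq; apply/and3P; split.
- exact: (@lt_sorted_uniq _ _ (c :: p1 ++ q1) (covlt _ _ l1P)).
(* A common vertex [w] is comparable with [b]. If [w] is at most [a], then either [w] is at most [c]
   or [b] is below [a]. If [w] is above [a], then either [a] is below [b] or [w] is a common upper
   bound under [z], against [zmin]. *)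
- apply/hasPn => w; rewrite mem_rev => /ml /andP[/andP[cw wz] wb].
  rewrite inE negb_or gt_eqF//= mem_cat; apply/negP => /orP[wp|wp].
    have /andP[_] := covle _ _ _ p1P wp; rewrite p1e => wa.
    case/orP: wb => bw; first by have := lt_geF cw; rewrite lexI wa bw.
    by rewrite (le_trans (ltW bw) wa) in nba.
  have /andP[aw _] := covle _ _ _ q1P wp.
  case/orP: wb => bw; first by rewrite (le_trans (ltW aw) bw) in nab.
  have Aw : A w by exact: covA q1P w wp.
  by have := zmin w Aw (ltW aw) (ltW bw); rewrite wz.
- have := @lt_sorted_uniq _ _ (c :: rcons m z) (covlt _ _ l2P).
  by rewrite /= rcons_uniq => /and3P[].
Qed.

(** * Positive weights on a forest *)

Lemma forest_mobius (d : Order.disp_t) (P : porderType d) (R : realType)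
    (f : P -> R) (T : seq P) :
  uniq T ->
  (forall z a b : P, z \in T -> a \in T -> b \in T ->
     (a <= z)%O -> (b <= z)%O -> (a >=< b)%O) ->
  (forall p, 0 < f p) -> strictly_order_preserving f ->
  exists2 g : P -> R, (forall z, 0 < g z) &
    {in T, forall y, f y = \sum_(z <- T | (z <= y)%O) g z}.
Proof.
move=> uT chT f0 fS.
(* On the chain below [z] the maximum is the value at the predecessor; the default 0 makes [g z]
   equal to [f z] when [z] is minimal in [T]. *)
pose g z := f z - \big[Num.max/0]_(w <- T | (w < z)%O) f w.
exists g => [z|].
  by rewrite subr_gt0; apply: bigmax_lt => // w; exact: fS.
suff: forall k, {in T, forall y, (count (<= y)%O T < k)%N ->
    f y = \sum_(z <- T | (z <= y)%O) g z}.
  by move=> + y yT => /(_ (count (<= y)%O T).+1); apply.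
elim=> // k IHk y yT yk.
have gE : f y = g y + \big[Num.max/0]_(w <- T | (w < y)%O) f w.
  by rewrite /g subrK.
rewrite big_mkcond (bigD1_seq y) //= lexx -big_mkcondr {1}gE; congr (_ + _).
under [RHS]eq_bigl do rewrite -lt_neqAle.
have [noy|[w [wT wy wmax]]] : (forall z, z \in T -> ~~ (z < y)%O) \/
    exists w, [/\ w \in T, (w < y)%O &
      forall z, z \in T -> (z < y)%O -> (z <= w)%O].
  (* Scan sublists of [T], keeping the greatest element below [y] met so far; two candidates are
     comparable by [chT]. *)
  have : {subset T <= T} by [].
  elim: {-2}T => [|t s IHs] sT; first by left.
  have tT : t \in T by apply: sT; rewrite mem_head.
  have {}IHs := IHs (fun z zs => sT z (mem_behead (s := t :: s) zs)).
  have [ty|nty] := boolP (t < y)%O; last first.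
    case: IHs => [no|[w [ws wy wm]]]; [left=> z|right; exists w].
      by rewrite inE => /predU1P[->//|/no].
    split=> //; first by rewrite inE ws orbT.
    by move=> z; rewrite inE => /predU1P[->|/wm //]; rewrite (negPf nty).
  right; case: IHs => [no|[w [ws wy wm]]].
    exists t; split; rewrite ?mem_head// => z; rewrite inE => /predU1P[->//|].
    by move=> /no/negPf->.
  have wT : w \in T by apply: sT; rewrite inE ws orbT.
  have /orP[tw|wt] := chT y t w yT tT wT (ltW ty) (ltW wy).
    exists w; split=> //; first by rewrite inE ws orbT.
    by move=> z; rewrite inE => /predU1P[->//|/wm].
  exists t; split; rewrite ?mem_head// => z.
  rewrite inE => /predU1P[->//|zs zy].
  exact: le_trans (wm z zs zy) wt.
  rewrite !(big_seq_cond (fun z => z < y)%O).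
  have no z : (z \in T) && (z < y)%O = false.
    by case: (boolP (z \in T)) => // /noy /negPf.
  by rewrite !big_pred0.
have -> : \big[Num.max/0]_(w <- T | (w < y)%O) f w = f w.
  apply/le_anti/andP; split; last exact: le_bigmax_seq.
  rewrite big_seq_cond; apply: bigmax_le => [|z /andP[zT zy]]; first exact: ltW.
  have := wmax z zT zy; rewrite le_eqVlt => /predU1P[->//|/fS]; exact: ltW.
(* The part of [T] strictly below [y] is the down-set of [w], to which the induction hypothesis
   applies. *)
have eqlw : {in T, forall z, (z < y)%O = (z <= w)%O}.
  move=> z zT; apply/idP/idP => [|zw]; [exact: wmax|exact: le_lt_trans wy].
rewrite (IHk w) //.
  rewrite big_seq_cond [RHS]big_seq_cond; apply: eq_bigl => z.
  by case: (boolP (z \in T)) => //= /eqlw ->.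
apply: leq_trans (yk : (_ <= k)%N).
apply: (@count_ltn _ _ _ _ y) ; rewrite /= ?lexx ?lt_geF //.
by move=> z zw; apply: le_trans zw (ltW wy).
Qed.

(** * The quadratic form as a weighted sum of squares *)

Lemma meet_matrix_posdef (d : Order.disp_t) (P : latticeType d) (R : realType)
    (f : P -> R) (n : nat) (x : 'I_n -> P) :
  locally_finite P -> (forall p, 0 < f p) -> injective x ->
  graph_acyclic (meetcl (range x)) (hasse (meetcl (range x))) ->
  strictly_order_preserving f -> posdefmx (meet_matrix x f).
Proof.
move=> lfP f0 xI acA fS; set A := meetcl (range x) in acA.
have meetA a b : A a -> A b -> A (Order.meet a b).
  by move=> Aa Ab B BP; exact: (BP.1 _ _ (Aa B BP) (Ab B BP)).
have Ax i : A (x i) by move=> B [_]; apply; exists i.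
(* A finite list of elements of [A] that contains every argument of [f] in the matrix, and each
   [x i] as its meet with itself. *)
pose T := undup [seq Order.meet (x i) (x j) | i <- enum 'I_n, j <- enum 'I_n].
have TA z : z \in T -> A z.
  by rewrite mem_undup => /allpairsP[[i j] [_ _ ->]]; exact: meetA.
have inT i j : Order.meet (x i) (x j) \in T.
  by rewrite mem_undup; apply: allpairs_f; rewrite mem_enum.
have [|g g0 fE] := @forest_mobius d P R f T (undup_uniq _) _ f0 fS.
  move=> z a b /TA Az /TA Aa /TA Ab.
  exact: (acyclic_downset_chain lfP meetA acA).
split; first by apply/matrixP => i j; rewrite !mxE meetC.
move=> v v0.
pose w z i := if (z <= x i)%O then v i 0 else 0.
have -> : (v^T *m meet_matrix x f *m v) 0 0 =
    \sum_(z <- T) g z * (\sum_i w z i) ^+ 2.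
  (* Expand the square and exchange sums: [z] lies below both [x i] and [x j] exactly when it lies
     below their meet. *)
  under [RHS]eq_bigr do rewrite expr2 big_distrlr/= mulr_sumr.
  rewrite exchange_big mxE; apply: eq_bigr => j _ /=.
  rewrite mxE mulr_suml.
  under [RHS]eq_bigr do rewrite mulr_sumr.
  rewrite exchange_big; apply: eq_bigr => i _ /=.
  rewrite !mxE fE ?inT// big_mkcond mulr_sumr mulr_suml.
  apply: eq_bigr => z _; rewrite lexI /w.
  case: (z <= x i)%O; case: (z <= x j)%O; rewrite /= ?(mulr0, mul0r)//.
  by rewrite [v i 0 * g z]mulrC -mulrA [v i 0 * _]mulrC.
have [i1 vi1] : exists i, v i 0 != 0 by apply/cV0Pn.
(* Maximizing [D] over the support of [v] makes [x i0] maximal there, since [D] grows strictly along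
   the order. *)
pose D i := #|[pred j | (x j <= x i)%O]|.
have [i0 vi0 i0max] : exists2 i, v i 0 != 0 &
    forall k, v k 0 != 0 -> (D k <= D i)%N.
  by case: (@arg_maxnP _ i1 (fun i => v i 0 != 0) D) => // i vi mi; exists i.
have wi0 : \sum_i w (x i0) i = v i0 0.
  rewrite (bigD1 i0) //= {1}/w lexx big1 ?addr0 // => k ki0.
  rewrite /w; case: ifP => // xk; apply: contraTeq isT => vk.
  have := i0max k vk; rewrite leqNgt => /negP; case.
  apply/proper_card/properP; split.
    by apply/fintype.subsetP => j; rewrite !inE => /le_trans; apply.
  exists k; rewrite !inE ?lexx //; apply: contra ki0 => kx.
  by apply/eqP/xI/le_anti; rewrite kx.
rewrite (bigD1_seq (x i0)) /= ?undup_uniq //; last by rewrite -[x i0]meetxx inT.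
rewrite ltr_pwDl //.
  by rewrite wi0 mulr_gt0 // lt_neqAle sqr_ge0 andbT eq_sym expf_neq0.
by rewrite sumr_ge0 // => z _; rewrite mulr_ge0 ?sqr_ge0 // ltW.
Qed.

(** * Passage to the dual lattice *)

(** Dualizing reverses each covering pair, which only swaps the two disjuncts of [hasse]. *)
Lemma hasse_dual (d : Order.disp_t) (P : porderType d) (A : set P) :
  hasse (P := P^d) A = hasse (P := P) A.
Proof.
have covE u v : @covered_in _ P^d A u v <-> @covered_in _ P A v u.
  by split=> -[Au Av uv no]; split=> // z /no; rewrite andbC.
apply/funext => u; apply/funext => v; rewrite /hasse; congr asbool.
by apply/propext; rewrite !covE; split=> -[]; auto.
Qed.

Theorem theorem4p5 (d : Order.disp_t) (P : latticeType d) (R : realType)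
    (f : P -> R) (n : nat) (x : 'I_n -> P)
    (P_infinite : infinite_set [set: P])
    (P_locally_finite : locally_finite P)
    (f_gt0 : forall p : P, 0 < f p)
    (x_distinct : injective x)
    (x_sorted : forall i j : 'I_n, (x i <= x j)%O -> (i <= j)%N) :
  (meet_tree_set (range x) -> strictly_order_preserving f ->
     posdefmx (meet_matrix x f)) /\
  (join_tree_set (range x) -> strictly_order_reversing f ->
     posdefmx (join_matrix x f)).
Proof.
split=> -[_ _ ac] fS; first exact: meet_matrix_posdef.
(* Meets of [P^d] are joins of [P] by conversion, so [join_matrix] and [joincl] are the meet notions
   of the dual. *)
apply: (@meet_matrix_posdef _ P^d R f n x) => //.
- move=> a b; have := P_locally_finite b a; congr finite_set.
  by apply/funext => z; rewrite /= andbC.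
- by rewrite hasse_dual.
- by move=> a b; apply: fS.
Qed.
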